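(* Let $X\subseteq\Sigma^{\mathbb{Z}^2}$ be a $\mathbb{Z}^2$-subshift containing no aperiodic configuration. Then there exist a vector $v\in\mathbb{Z}^2$ and a one-dimensional subshift $Y$ (over some finite alphabet) such that the dynamical system $(X,\sigma_v)$ is almost topologically conjugate to $(Y,\sigma)$. Moreover, if $X$ is a subshift of finite type, then $Y$ can be chosen to be a subshift of finite type.
   Context: A $\mathbb{Z}^d$-subshift is a closed shift-invariant subset of $\Sigma^{\mathbb{Z}^d}$ ($\Sigma$ finite, product topology, $(\sigma_v(x))_z=x_{z+v}$); $\sigma$ denotes the shift $\sigma_1$ on $\mathbb{Z}$. A subshift of finite type is one of the form $X_{\mathcal F}$ (configurations containing no translate of any pattern of a finite set $\mathcal F$). A configuration is aperiodic if no nonzero $v$ satisfies $x_{z+v}=x_z$ for all $z$. Dynamical systems $(C_1,\Phi_1)$ and $(C_2,\Phi_2)$ ($C_i$ compact, $\Phi_i$ continuous) are almost topologically conjugate if there is a dynamical system $(C_3,\Phi_3)$ and continuous surjections $\pi_i:C_3\to C_i$, each injective except on a finite set of points, with $\pi_i\circ\Phi_3=\Phi_i\circ\pi_i$ for $i=1,2$. *)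

(* Defs.v *)
From HB Require Import structures.
From mathcomp Require Import all_boot all_algebra finmap.
From mathcomp Require Import classical_sets functions cardinality topology.

Set Implicit Arguments.
Unset Strict Implicit.
Unset Printing Implicit Defensive.

Import GRing.Theory.
Local Open Scope classical_set_scope.
Local Open Scope ring_scope.

(* Z^d-subshifts are treated uniformly for an abelian index group G; here G is
   int * int for Z^2 and int for Z.  Configurations carry the product of the
   discrete topologies on the alphabet. *)
Definition config (G : zmodType) (A : finType) : topologicalType :=
  {ptws G -> discrete_topology A}.

Section Subshifts.
Variables (G : zmodType) (A : finType).

Definition shift (v : G) (x : config G A) : config G A := fun z => x (z + v).

Definition subshift (X : set (config G A)) :=
  closed X /\ forall v : G, shift v @` X `<=` X.

(* A pattern is a finite-support partial map p from G to the alphabet; it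
   appears in x at z when x (z + u) = p u for every u in the support of p. *)
Definition appears (p : {fmap G -> A}) (x : config G A) :=
  exists z : G, forall u : G, u \in domf p -> p.[? u]%fmap = Some (x (z + u)).

Definition avoiding (F : {fset {fmap G -> A}}) : set (config G A) :=
  [set x | forall p, p \in F -> ~ appears p x].

Definition finite_type (X : set (config G A)) :=
  exists F : {fset {fmap G -> A}}, X = avoiding F.

Definition aperiodic (x : config G A) :=
  forall v : G, v != 0 -> ~ (forall z, x (z + v) = x z).

End Subshifts.

(* The system (C, Phi) is given by a subset C of an ambient space and a map on
   that space, of which only the restriction to C matters. *)
Definition dynamical_system (T : topologicalType) (C : set T) (Phi : T -> T) :=
  [/\ compact C, Phi @` C `<=` C & {within C, continuous Phi}].

Definition almost_factor_map (T3 T : topologicalType)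
    (C3 : set T3) (Phi3 : T3 -> T3) (C : set T) (Phi : T -> T) (f : T3 -> T) :=
  [/\ {within C3, continuous f},
      f @` C3 = C,
      exists E : set T3, finite_set E /\ set_inj (C3 `\` E) f
    & forall c, C3 c -> f (Phi3 c) = Phi (f c)].

Definition almost_conjugate (T1 T2 : topologicalType)
    (C1 : set T1) (Phi1 : T1 -> T1) (C2 : set T2) (Phi2 : T2 -> T2) :=
  [/\ dynamical_system C1 Phi1, dynamical_system C2 Phi2
    & exists (T3 : topologicalType) (C3 : set T3) (Phi3 : T3 -> T3)
             (pi1 : T3 -> T1) (pi2 : T3 -> T2),
      [/\ dynamical_system C3 Phi3,
          almost_factor_map C3 Phi3 C1 Phi1 pi1
        & almost_factor_map C3 Phi3 C2 Phi2 pi2]].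

(* Main.v *)
Require Import Defs.
From HB Require Import structures.
From mathcomp Require Import all_boot all_algebra finmap.
From mathcomp Require Import boolp classical_sets functions cardinality topology.
From mathcomp Require Import zify ring.

(**
The configurations of X have finitely many common periods. Call a window of x
v-periodic if x (t + v) = x t for all t in it. If every window of some large
size is periodic for one of finitely many pairwise non-collinear vectors v_i, a
place where a multiple of some v_j fails has a unique local period v_i, and the
failure propagates along the whole line of direction v_i; two such lines of
different directions would come close to each other, which is impossible, so x
has a multiple of one of the v_i as a global period. Hence being covered by
finitely many periods passes from a subshift to all subshifts in one of its
neighbourhoods, and by compactness a subshift without such a cover contains a
minimal one. By Baire's theorem a minimal one has a nonempty cylinder of
configurations with a common period; removing the orbit of this cylinder leaves
a finitely covered subshift, a contradiction.

Take a cover by pairwise non-collinear periods u_1, ..., u_k and a vector v that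
is collinear to none of them. A configuration of period u_i is coded by the
sequence of its contents in the translates of a finite box by multiples of v,
together with the label i. The codes form a one-dimensional subshift, and
decoding identifies codes with different labels i, j only on the finitely many
configurations with both periods u_i and u_j.
*)

Set Implicit Arguments.
Unset Strict Implicit.
Unset Printing Implicit Defensive.

Import GRing.Theory Num.Theory.
Local Open Scope classical_set_scope.
Local Open Scope ring_scope.

(** * The topology of configuration spaces *)

Definition agree (G : zmodType) (A : finType) (S : seq G) (x y : config G A) :=
  forall s, s \in S -> x s = y s.

Section ConfigTopology.
Variables (G : zmodType) (A : finType).
Implicit Types (x y : config G A) (S : seq G) (P X : set (config G A)).

Lemma nbhs_agree S x : nbhs x [set y | agree S x y].
Proof.
elim: S => [|s S IH]; first by apply: filterS filterT => y _ s; rewrite in_nil.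
have /= hs : nbhs x [set y : config G A | y s = x s].
  exact: (@proj_continuous G (fun=> discrete_topology A) s x _
    (discrete_set1 (x s : discrete_topology A))).
apply: filterS (filterI hs IH) => y [/= e1 e2] t.
by rewrite inE => /orP[/eqP->|/e2].
Qed.

Lemma locally_determined_open P S :
  (forall x y, agree S x y -> P x -> P y) -> open P.
Proof.
move=> h; rewrite openE => x Px; apply: filterS (nbhs_agree S x) => y xy.
exact: h xy Px.
Qed.

Lemma locally_determined_closed P S :
  (forall x y, agree S x y -> P x -> P y) -> closed P.
Proof.
move=> h; rewrite -[P]setCK closedC; apply: (@locally_determined_open _ S).
by move=> x y xy nPx Py; apply: nPx; apply: h Py => s sS; rewrite xy.
Qed.

Lemma config_compact : compact [set: config G A].
Proof.
have := @tychonoff G (fun=> discrete_topology A) (fun=> setT).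
have -> : [set f : forall i : G, discrete_topology A | forall i, setT (f i)] = setT.
  by apply/seteqP.
by apply=> _; apply: finite_compact; exact: (@finite_finset A).
Qed.

Lemma config_hausdorff : hausdorff_space (config G A).
Proof.
apply: (@hausdorff_product G (fun=> discrete_topology A)) => _.
exact: discrete_hausdorff.
Qed.

Lemma closed_config_compact X : closed X -> compact X.
Proof. by move=> cX; apply: subclosed_compact cX config_compact _. Qed.

Lemma locally_determined_continuous (H : zmodType) (B : finType)
    (f : config G A -> config H B) (S : H -> seq G) :
  (forall z x y, agree (S z) x y -> f x z = f y z) -> continuous f.
Proof.
move=> h x.
have FF : Filter (f y @[y --> x]) := @fmap_filter _ _ f (nbhs x) (nbhs_filter x).
apply/cvg_sup => z; apply/cvg_image.
  by apply/seteqP; split=> // b _; exists (fun=> b).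
move=> W /principal_filterP Wfx.
exists [set g : H -> discrete_topology B | W (g z)].
  apply: filterS (nbhs_agree (S z) x) => y xy /=.
  by rewrite -(h _ _ _ xy).
by apply/seteqP; split=> [b [g Wg <-]//|b Wb]; exists (fun=> b).
Qed.

Lemma shift_continuous v : continuous (@shift G A v).
Proof.
apply: (@locally_determined_continuous _ _ _ (fun z => [:: z + v])) => z x y.
by apply; rewrite inE.
Qed.

Lemma shift_shift u v x : shift u (shift v x) = shift (u + v) x.
Proof. by apply/funext => z; rewrite /shift addrA. Qed.

Lemma shift0 x : shift 0 x = x.
Proof. by apply/funext => z; rewrite /shift addr0. Qed.

Lemma subshift_shift X v x : subshift X -> X x -> X (shift v x).
Proof. by case=> _ h Xx; apply: h; exists x. Qed.

End ConfigTopology.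

(** The sets [Z i] generate a proper filter; a cluster point of it lies in every [Z i], these being
    closed. *)
Lemma compact_directed_nonempty (T : topologicalType) (K : set T) (I : Type)
    (D : set I) (Z : I -> set T) :
  compact K -> D !=set0 ->
  (forall i, D i -> [/\ closed (Z i), Z i `<=` K & Z i !=set0]) ->
  (forall i j, D i -> D j -> exists2 k, D k & Z k `<=` Z i `&` Z j) ->
  exists2 x, K x & forall i, D i -> Z i x.
Proof.
move=> cK [i0 Di0] hZ hdir.
have FF : ProperFilter (filter_from D Z).
  apply: filter_from_proper; last by move=> i /hZ[].
  by apply: filter_from_filter => //; exists i0.
have FK : filter_from D Z K by exists i0 => //; have [] := hZ _ Di0.
have [x [Kx clx]] := cK _ FF FK.
exists x => // i Di; have [cl _ _] := hZ _ Di.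
apply: cl => U nU; apply: clx => //; exists i => //.
Qed.

Definition periodic (G : zmodType) (A : finType) (v : G) : set (config G A) :=
  [set x | forall z, x (z + v) = x z].

Arguments periodic {G} A v _.

Section Periodic.
Variables (G : zmodType) (A : finType).
Implicit Types (x : config G A) (v : G).

Lemma closed_periodic v : closed (periodic A v).
Proof.
have -> : periodic A v = \bigcap_(z in [set: G]) [set x : config G A | x (z + v) = x z].
  by apply/seteqP; split=> [x h z _|x h z]; [exact: h|exact: (h z)].
apply: closed_bigI => z _; apply: (@locally_determined_closed _ _ _ [:: z + v; z]).
by move=> x y xy /= e; rewrite -!xy // !inE eqxx ?orbT.
Qed.

Lemma periodic_shift u v x : periodic A v (shift u x) = periodic A v x.
Proof.
apply/propext; split=> h z; last by rewrite /shift addrAC h.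
by have := h (z - u); rewrite /shift addrAC !addrNK.
Qed.

Lemma periodicMz v (n : int) x : periodic A v x -> periodic A (v *~ n) x.
Proof.
move=> h; elim/int_rec: n => [|n IH|n IH] z; first by rewrite mulr0z addr0.
- by rewrite -addn1 PoszD mulrzDr addrA mulr1z h IH.
- by rewrite -addn1 PoszD opprD mulrzDr addrA mulrN1z -[RHS]IH -[LHS]h addrNK.
Qed.

End Periodic.

(** * From local to global periods *)

Local Notation Z2 := (int * int)%type.

Definition vdet (u v : Z2) : int := u.1 * v.2 - u.2 * v.1.
Definition vnorm (u : Z2) : nat := (`|u.1| + `|u.2|)%N.

Arguments vnorm u%_ring_scope.
Arguments vdet (u v)%_ring_scope.

Section PlaneVectors.
Implicit Types u v w z : Z2.

Lemma vMzE u (n : int) : u *~ n = (u.1 * n, u.2 * n).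
Proof.
by rewrite [LHS]surjective_pairing (raddfMz fst) (raddfMz snd) !mulrzz.
Qed.

Lemma cramer u v w : w *~ vdet u v = u *~ vdet w v + v *~ vdet u w.
Proof. by rewrite !vMzE /vdet; congr (_, _) => /=; ring. Qed.

Lemma vdetMl u v (n : int) : vdet (u *~ n) v = vdet u v * n.
Proof. by rewrite vMzE /vdet /=; ring. Qed.

Lemma vdetDl u v w : vdet (u + v) w = vdet u w + vdet v w.
Proof. by rewrite /vdet /=; ring. Qed.

Lemma vdetvv u : vdet u u = 0.
Proof. by rewrite /vdet mulrC subrr. Qed.

Lemma vnormD u v : (vnorm (u + v) <= vnorm u + vnorm v)%N.
Proof. by rewrite /vnorm /=; lia. Qed.

Lemma vnormN u : vnorm (- u) = vnorm u.
Proof. by rewrite /vnorm /= !abszN. Qed.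

Lemma vnorm0 : vnorm 0 = 0%N. Proof. by []. Qed.

Lemma vnormMz u (n : int) : vnorm (u *~ n) = (vnorm u * `|n|)%N.
Proof. by rewrite vMzE /vnorm /= !abszM mulnDl. Qed.

Lemma vdet_norm u v : (`|vdet u v| <= vnorm u * vnorm v)%N.
Proof.
rewrite /vdet /vnorm; set a := u.1; set b := u.2; set c := v.1; set d := v.2.
have h : (`|(a * d - b * c)%R| <= `|(a * d)%R| + `|(b * c)%R|)%N by lia.
by apply: leq_trans h _; rewrite !abszM mulnDl !mulnDr; lia.
Qed.

Definition vquo z (d : int) : Z2 := ((z.1 %/ d)%Z, (z.2 %/ d)%Z).
Definition vrem z (d : int) : Z2 := ((z.1 %% d)%Z, (z.2 %% d)%Z).

(* Cramer's rule puts [vdet u v * Z^2] inside the lattice spanned by [u] and [v]. *)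
Lemma vdecomp u v z :
  z = u *~ vdet (vquo z (vdet u v)) v + v *~ vdet u (vquo z (vdet u v)) +
      vrem z (vdet u v).
Proof.
set d := vdet u v.
rewrite -cramer vMzE /vquo /vrem /=.
by rewrite [LHS]surjective_pairing [in LHS](divz_eq z.1 d) [in LHS](divz_eq z.2 d).
Qed.

Lemma vrem_bound z (d : int) : d != 0 ->
  [/\ 0 <= (vrem z d).1, 0 <= (vrem z d).2,
      (`|(vrem z d).1| < `|d|)%N & (`|(vrem z d).2| < `|d|)%N].
Proof.
move=> d0; rewrite /vrem /=.
have h a : 0 <= (a %% d)%Z by exact: modz_ge0.
have k a : (a %% d)%Z < `|d| by exact: ltz_mod.
by split; rewrite ?h //; have := h z.1; have := h z.2; have := k z.1; have := k z.2; lia.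
Qed.

End PlaneVectors.

Section LocalPeriods.
Variables (A : finType) (x : config Z2 A).

Definition locally_periodic (r : nat) (v z : Z2) :=
  forall t, (vnorm (t - z) <= r)%N -> x (t + v) = x t.

Lemma locally_periodic_sub r r' v z z' :
  (vnorm (z' - z) + r' <= r)%N -> locally_periodic r v z -> locally_periodic r' v z'.
Proof.
move=> le h t ht; apply: h.
have -> : t - z = (t - z') + (z' - z) by rewrite addrA addrNK.
by apply: leq_trans (vnormD _ _) _; lia.
Qed.

(** The bound keeps the whole walk from [t] by steps [v] inside the window. *)
Lemma locally_periodicMz r v z (n : int) t : locally_periodic r v z ->
  (vnorm (t - z) + vnorm v * `|n| <= r)%N -> x (t + v *~ n) = x t.
Proof.
move=> h; elim/int_rec: n => [|n IH|n IH] le.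
- by rewrite mulr0z addr0.
- rewrite -addn1 PoszD mulrzDr mulr1z addrA h; last first.
    rewrite addrAC; apply: leq_trans (vnormD _ _) _.
    by rewrite vnormMz; move: le; rewrite /= mulnS; set N := vnorm (t - z); lia.
  by apply: IH; move: le; rewrite /= mulnS; lia.
- have le' : (vnorm (t - z) + vnorm v * n.+1 <= r)%N by move: le; rewrite abszN.
  rewrite -IH; last by rewrite abszN /=; move: le'; rewrite mulnS; lia.
  rewrite -[in LHS]h.
    by rewrite -addn1 PoszD opprD mulrzDr mulrN1z addrA addrNK.
  rewrite addrAC; apply: leq_trans (vnormD _ _) _.
  by rewrite vnormMz abszN.
Qed.

End LocalPeriods.

Definition noncollinear (V : seq Z2) :=
  {in V &, forall u v, u != v -> vdet u v != 0}.

Section LocalToGlobal.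
Variables (V : seq Z2) (ncV : noncollinear V).

Let R := (\sum_(v <- V) vnorm v)%N.

Let normR v : v \in V -> (vnorm v <= R)%N.
Proof. by move=> vV; rewrite /R (big_rem v) //= leq_addr. Qed.

Let detR u v : u \in V -> v \in V -> (`|vdet u v| <= R * R)%N.
Proof. by move=> /normR uR /normR vR; apply: leq_trans (vdet_norm u v) (leq_mul _ _). Qed.

(** Divisible by [vdet u v] for all [u != v] in [V], since these determinants are nonzero and at
    most [R * R] in absolute value. *)
Let m := (R * R)`!%N.
Let r0 := (2 * (R * (R * R * m)))%N.
(** Beyond [r0] there is room for the distance allowed in [bad_unique] and for a jump by
    [w *~ m]. *)
Let r := (r0 + 2 * R + 2 * (R * R) + R * m)%N.

Section Point.
Variables (A : finType) (x : config Z2 A).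
Hypothesis cov : forall z, exists2 v, v \in V & locally_periodic x r v z.

(** By Cramer's rule [w *~ vdet v v'], hence also [w *~ m], is an integer combination of [v] and
    [v']; [r0] leaves room to walk along its two legs. *)
Let two_periods v v' w z : v \in V -> v' \in V -> w \in V -> v != v' ->
  locally_periodic x r0 v z -> locally_periodic x r0 v' z -> x (z + w *~ m) = x z.
Proof.
move=> vV v'V wV /(ncV vV v'V) d0 hv hv'.
have [k mk] : exists k : int, m%:Z = vdet v v' * k.
  have /dvdnP[q mq] : (`|vdet v v'| %| m)%N.
    by apply: dvdn_fact; rewrite absz_gt0 d0 detR.
  exists (Posz q * sgz (vdet v v')); rewrite mq PoszM abszEsg; ring.
have km : (`|k| <= m)%N.
  have -> : m = (`|vdet v v'| * `|k|)%N by rewrite -abszM -mk.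
  by apply: leq_pmull; rewrite absz_gt0.
have b1 u u' w1 : u \in V -> u' \in V -> w1 \in V ->
    (vnorm w1 * `|(vdet u u' * k)%R| <= R * (R * R * m))%N.
  by move=> uV u'V wV'; rewrite abszM !leq_mul // ?detR ?normR.
rewrite mk mulrzA cramer mulrzDl -!mulrzA addrA.
rewrite (locally_periodicMz (r := r0) (z := z)) //; last first.
  rewrite addrAC subrr add0r vnormMz /r0 mul2n -addnn.
  by apply: leq_add; apply: b1.
rewrite (locally_periodicMz (r := r0) (z := z)) // subrr vnorm0 add0n.
by apply: leq_trans (b1 _ _ _ _ _ _) _ => //; rewrite /r0 leq_pmull.
Qed.

Let bad z := exists2 w, w \in V & x (z + w *~ m) <> x z.

(** Otherwise both periods would hold within [r0] of [z], and [two_periods] would contradict the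
    failure there. *)
Let bad_unique v v' z z' : v \in V -> v' \in V -> bad z ->
  (vnorm (z - z') <= 2 * R + 2 * (R * R))%N ->
  locally_periodic x r v z -> locally_periodic x r v' z' -> v = v'.
Proof.
move=> vV v'V [w wV neq] zz' hv hv'; apply/eqP/negPn/negP => vv'; apply: neq.
apply: (two_periods vV v'V wV vv').
- by apply: locally_periodic_sub hv; rewrite subrr vnorm0 /r; lia.
- by apply: locally_periodic_sub hv'; move: zz'; rewrite /r; set N := vnorm (z - z'); lia.
Qed.

(** A step along the local period changes neither [x z] nor [x (z + w *~ m)], so the failure moves
    along. By [bad_unique] the local period supplied by [cov] at the new point is again [v]. *)
Let bad_step v e z : v \in V -> e = 1 \/ e = -1 -> bad z -> locally_periodic x r v z ->
  bad (z + v *~ e) /\ locally_periodic x r v (z + v *~ e).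
Proof.
move=> vV e1 bz hv.
have e1' : `|e|%N = 1%N by case: e1 => ->.
have nv := normR vV.
have bz' : bad (z + v *~ e).
  have [w wV neq] := bz; exists w => //; have nw := leq_mul (normR wV) (leqnn m).
  rewrite addrAC !(locally_periodicMz hv) // ?e1' ?subrr ?vnorm0 ?muln1 ?/r; first lia.
  by rewrite addrAC subrr add0r vnormMz /= /r; lia.
split=> //; have [v' v'V hv'] := cov (z + v *~ e).
suff e' : v' = v by rewrite e' in hv'.
apply/esym; apply: bad_unique bz _ hv hv' => //.
by rewrite opprD addrA subrr add0r vnormN vnormMz e1'; lia.
Qed.

Let bad_line v z (n : int) : v \in V -> bad z -> locally_periodic x r v z ->
  bad (z + v *~ n) /\ locally_periodic x r v (z + v *~ n).
Proof.
move=> vV bz hv; elim/int_rec: n => [|n [b h]|n [b h]]; first by rewrite mulr0z addr0.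
- by rewrite -addn1 PoszD mulrzDr addrA; apply: bad_step => //; left.
- by rewrite -addn1 PoszD opprD mulrzDr addrA; apply: bad_step => //; right.
Qed.

Lemma global_period : exists2 v, v \in V & periodic A (v *~ m) x.
Proof.
have [[p bp]|nb] := pselect (exists p, bad p); last first.
  have [v vV _] := cov 0; exists v => // z.
  by apply: contrapT => neq; apply: nb; exists z, v.
have [v vV hv] := cov p; exists v => // q; apply: contrapT => neq.
have bq : bad q by exists v.
have [v' v'V hv'] := cov q.
(* With [v = v'], the window at [q] would be large enough to rule out the failure of [v *~ m] at
   [q]. *)
have vv' : v != v'.
  apply/eqP => e; apply: neq; rewrite e; apply: (locally_periodicMz hv').
  by rewrite subrr vnorm0 /r; have := leq_mul (normR v'V) (leqnn m); rewrite /=; lia.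
have d0 := ncV vV v'V vv'.
(* The line through [p] along [v] and the line through [q] along [v'] contain bad points whose
   difference is a remainder modulo [vdet v v']; they are too close to have different local
   periods. *)
have := vdecomp v v' (p - q); set a := vdet (vquo _ _) v'; set b := vdet v (vquo _ _) => e.
have [bp1 hp1] := bad_line (- a) vV bp hv.
have [_ hq1] := bad_line b v'V bq hv'.
move/eqP: vv'; apply; apply: bad_unique bp1 _ hp1 hq1 => //.
have -> : p + v *~ - a - (q + v' *~ b) = vrem (p - q) (vdet v v').
  by apply/eqP; rewrite mulrNz opprD addrACA -opprD subr_eq [X in _ == X]addrC; exact/eqP.
have [_ _ h1 h2] := vrem_bound (p - q) d0.
by have := detR vV v'V; rewrite /vnorm; lia.
Qed.

End Point.

Lemma local_to_global : exists (r m : nat), (0 < m)%N /\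
  forall (A : finType) (x : config Z2 A),
    (forall z, exists2 v, v \in V & locally_periodic x r v z) ->
    exists2 v, v \in V & periodic A (v *~ m) x.
Proof. by exists r, m; split; [exact: fact_gt0|exact: global_period]. Qed.

End LocalToGlobal.

(** * Finitely many periods suffice *)

Section Balls.
Variable A : finType.
Implicit Types (x y : config Z2 A) (P : set (config Z2 A)).

Definition ball_agree (n : nat) x y := forall t, (vnorm t <= n)%N -> x t = y t.

Lemma ball_finite (n : nat) : exists S : seq Z2, forall t, (vnorm t <= n)%N -> t \in S.
Proof.
pose I : seq int := [seq k%:Z - n%:Z | k <- iota 0 (n + n).+1].
have mI (a : int) : (`|a| <= n)%N -> a \in I.
  move=> an; apply/mapP; exists `|(a + n%:Z)%R|%N; last lia.
  by rewrite mem_iota; lia.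
exists [seq (a, b) | a <- I, b <- I] => -[a b] le; rewrite /vnorm in le.
by apply/allpairsP; exists (a, b); split=> //; apply: mI; move: le => /=; lia.
Qed.

Lemma ball_determined_open P n :
  (forall x y, ball_agree n x y -> P x -> P y) -> open P.
Proof.
have [S hS] := ball_finite n => h; apply: (@locally_determined_open _ _ _ S).
by move=> x y xy; apply: h => t /hS /xy.
Qed.

Lemma ball_determined_closed P n :
  (forall x y, ball_agree n x y -> P x -> P y) -> closed P.
Proof.
have [S hS] := ball_finite n => h; apply: (@locally_determined_closed _ _ _ S).
by move=> x y xy; apply: h => t /hS /xy.
Qed.

End Balls.

Definition finitely_periodic (A : finType) (X : set (config Z2 A)) :=
  exists2 V : seq Z2, 0 \notin V &
    forall x, X x -> exists2 v, v \in V & periodic A v x.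

Lemma common_multiple u v : u != 0 -> v != 0 -> vdet u v = 0 ->
  exists a b : int, u *~ a = v *~ b /\ u *~ a != 0.
Proof.
case: u v => [a b] [c d]; rewrite /vdet /= => u0 v0 e.
have e' : a * d = b * c by apply/eqP; rewrite -subr_eq0 e.
have [a0|a0] := eqVneq a 0.
  have b0 : b != 0 by apply: contraNneq u0 => b0; rewrite a0 b0.
  have c0 : c = 0 by move: e' => /esym/eqP; rewrite a0 mul0r mulf_eq0 (negPf b0) => /eqP.
  have d0 : d != 0 by apply: contraNneq v0 => d0; rewrite c0 d0.
  exists d, b; rewrite !vMzE /= a0 c0 !mul0r mulrC; split=> //.
  by rewrite xpair_eqE negb_and mulf_neq0 ?orbT.
have c0 : c != 0.
  apply: contraNneq v0 => c0; move: e' => /eqP; rewrite c0 mulr0 mulf_eq0 (negPf a0) /=.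
  by move=> /eqP->.
exists c, a; rewrite !vMzE /= -e'; split; first by rewrite mulrC [d * a]mulrC.
by rewrite xpair_eqE negb_and mulf_neq0.
Qed.

(* A cover of minimal size has no two collinear vectors: these could be
   replaced by a common multiple. *)
Lemma noncollinear_cover (A : finType) (X : set (config Z2 A)) :
  finitely_periodic X ->
  exists V : seq Z2, [/\ noncollinear V, 0 \notin V &
    forall x, X x -> exists2 v, v \in V & periodic A v x].
Proof.
move=> [V0 V00 cov0].
pose covers (V : seq Z2) := 0 \notin V /\
  forall x, X x -> exists2 v, v \in V & periodic A v x.
pose Q n := `[< exists2 V : seq Z2, covers V & size V = n >].
have exQ : exists n, Q n by exists (size V0); apply/asboolP; exists V0.
case: (ex_minnP exQ) => n /asboolP[V [V0' cov] sV] nmin.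
exists V; split=> // u v uV vV uv; apply/eqP => det0.
have nz w : w \in V -> w != 0 by apply: contraTneq => ->.
have [a [b [e w0]]] := common_multiple (nz _ uV) (nz _ vV) det0.
have vV' : v \in rem u V.
  by move: vV; rewrite (perm_mem (perm_to_rem uV)) inE eq_sym (negPf uv).
pose V' := u *~ a :: rem v (rem u V).
have : Q (size V').
  apply/asboolP; exists V' => //; split.
    rewrite inE eq_sym negb_or w0 /=; apply: contra V0' => /mem_rem /mem_rem //.
  move=> x /cov[w wV hw].
  have [wu|wu] := eqVneq w u.
    by exists (u *~ a); [rewrite inE eqxx|rewrite -wu; exact: periodicMz].
  have [wv|wv] := eqVneq w v.
    by exists (u *~ a); [rewrite inE eqxx|rewrite e -wv; exact: periodicMz].
  exists w => //; move: wV.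
  rewrite (perm_mem (perm_to_rem uV)) inE (negPf wu) /=.
  by rewrite (perm_mem (perm_to_rem vV')) inE (negPf wv) /= inE => ->; rewrite orbT.
move/nmin; rewrite -sV /= !size_rem //.
have : (0 < size (rem u V))%N by case: (rem u V) vV'.
by rewrite size_rem //; case: (size V) => [|[|k]] // _; rewrite ltnn.
Qed.

(** Having a local period from [V] at the origin is an open condition. A subshift satisfying it has,
    by invariance, such a period at every point, so [local_to_global] yields the cover by the
    vectors [v *~ m]. *)
Lemma finitely_periodic_nbhs (A : finType) (X : set (config Z2 A)) :
  finitely_periodic X ->
  exists O : set (config Z2 A), [/\ open O, X `<=` O &
    forall Z, subshift Z -> Z `<=` O -> finitely_periodic Z].
Proof.
move=> /noncollinear_cover[V [ncV V0 cov]].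
have [r [m [m0 l2g]]] := local_to_global ncV.
pose R := (\sum_(v <- V) vnorm v)%N.
exists [set x | exists2 v, v \in V & locally_periodic x r v 0]; split.
- apply: (@ball_determined_open _ _ (r + R)) => x y xy [v vV h].
  have vR : (vnorm v <= R)%N by rewrite /R (big_rem v) //= leq_addr.
  exists v => // t; rewrite subr0 => tr.
  rewrite -!xy; first by apply: h; rewrite subr0.
    by apply: leq_trans tr _; rewrite leq_addr.
  by apply: leq_trans (vnormD _ _) _; apply: leq_add.
- by move=> x /cov[v vV h]; exists v => // t _; exact: h.
- move=> Z sZ ZO; exists [seq v *~ m | v <- V].
    apply: contra V0 => /mapP[v vV /esym/eqP]; rewrite vMzE xpair_eqE !mulf_eq0.
    rewrite (_ : (m%:Z == 0) = false) ?orbF; last by apply/negbTE; lia.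
    by rewrite -xpair_eqE -surjective_pairing => /eqP e; rewrite (_ : 0 = v) // e.
  move=> x Zx; have [|v vV h] := l2g _ x.
    move=> z; have [v vV h] := ZO _ (subshift_shift z sZ Zx).
    exists v => // t tz; have := h (t - z); rewrite subr0 => /(_ tz).
    by rewrite /shift addrAC addrNK.
  by exists (v *~ m) => //; apply: map_f.
Qed.

Lemma subshiftD_open (A : finType) (X O : set (config Z2 A)) :
  subshift X -> open O -> (forall u x, O (shift u x) -> O x) -> subshift (X `\` O).
Proof.
move=> sX oO iO; split; first by apply: closedI; [case: sX|exact: open_closedC].
move=> u _ [x [Xx nOx] <-]; split; first exact: subshift_shift.
by move=> /iO.
Qed.

(** * Minimal subshifts and Baire category *)

Section AllPeriodic.
Variables (A : finType) (X : set (config Z2 A)).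
Hypotheses (hX : subshift X) (hap : forall x, X x -> ~ aperiodic x).

(** Zorn's lemma is applied to the removed sets, so chains are bounded by their unions. If what
    remains after removing such a union were finitely periodic, compactness would put the remainder
    for some member of the chain, or [X] itself, inside its neighbourhood [U]. *)
Lemma minimal_not_finitely_periodic : ~ finitely_periodic X ->
  exists M : set (config Z2 A), [/\ subshift M, M `<=` X, ~ finitely_periodic M &
    forall O, subshift (M `\` O) -> M `&` O !=set0 -> finitely_periodic (M `\` O)].
Proof.
move=> bad.
pose P (O : set (config Z2 A)) := subshift (X `\` O) /\ ~ finitely_periodic (X `\` O).
have P0 : P set0 by rewrite /P setD0.
have [|O0 [[sM bM] maxO]] := @Zorn_bigcup _ P; last first.
  exists (X `\` O0); split=> // O sO [x [[Xx nO0x] Ox]].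
  apply: contrapT => nf; apply: (maxO (O0 `|` O)).
    by split; [left|move=> /(_ x) h; apply: nO0x; apply: h; right].
  by rewrite /P -setDDl; split.
move=> F FP Ftot; split.
  split.
    rewrite (_ : _ `\` _ = X `&` \bigcap_(O in F) (X `\` O)).
      apply: closedI; first by case: hX.
      by apply: closed_bigI => O /FP[[]].
    apply/seteqP; split=> x [Xx h]; split=> //.
      by move=> O FO; split=> // Ox; apply: h; exists O.
    by move=> [O FO Ox]; have [] := h O FO.
  move=> u _ [x [Xx nx] <-]; split; first exact: subshift_shift.
  move=> [O FO Ox]; have [sO _] := FP _ FO.
  have [] : (X `\` O) (shift u x); last by [].
  by apply: subshift_shift => //; split=> // Ox'; apply: nx; exists O.
move=> /finitely_periodic_nbhs[U [oU XU hU]].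
(* Adding [set0] makes the family nonempty even for the empty chain. *)
pose D (O : set (config Z2 A)) := F O \/ O = set0.
have DP O : D O -> P O by case=> [/FP//|->].
have [||||x Xx hx] := @compact_directed_nonempty _ X _ D (fun O => (X `\` O) `\` U).
- by apply: closed_config_compact; case: hX.
- by exists set0; right.
- move=> O /DP[sO bO]; split.
  + by apply: closedI; [case: sO|exact: open_closedC].
  + by move=> x [[]].
  + apply: contrapT => ne; apply: bO; apply: hU => // x Ox.
    by apply: contrapT => nU; apply: ne; exists x.
- have sub (O O' : set (config Z2 A)) : O `<=` O' ->
      (X `\` O') `\` U `<=` ((X `\` O) `\` U) `&` ((X `\` O') `\` U).
    by move=> OO' x [[Xx nO'] nU]; split=> //; split=> //; split=> // /OO'.
  move=> O O' DO DO'.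
  have [OO'|O'O] : O `<=` O' \/ O' `<=` O.
  + case: DO DO' => [FO|->] [FO'|->]; [exact: Ftot|by right|by left|by left].
  + by exists O' => //; exact: sub.
  + by exists O => //; rewrite setIC; exact: sub.
- have [_ nU] := hx set0 (or_intror erefl).
  apply: nU; apply: XU; split=> // -[O FO Ox].
  by have [[]] := hx O (or_introl FO).
Qed.

(* Baire category: otherwise successively smaller cylinders would exclude all
   periods one after the other. *)
Lemma cylinder_with_common_period (M : set (config Z2 A)) :
  closed M -> M `<=` X -> M !=set0 ->
  exists v x n, [/\ v != 0, M x &
    forall y, M y -> ball_agree n x y -> periodic A v y].
Proof.
move=> cM MX [x0 Mx0]; apply: contrapT => no.
(* A pair of a centre and a radius stands for a cylinder, which is shrunk until it excludes one
   given period. The premise on [M] sits under the existential so that [choice] gives a total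
   function. *)
have step (sv : (config Z2 A * nat) * Z2) : exists s' : config Z2 A * nat,
    M sv.1.1 -> [/\ M s'.1, ball_agree sv.1.2 sv.1.1 s'.1, (sv.1.2 <= s'.2)%N &
      sv.2 != 0 -> forall y, ball_agree s'.2 s'.1 y -> ~ periodic A sv.2 y].
  case: sv => -[x n] v /=.
  have [nMx|Mx] := pselect (~ M x); first by exists (x, n).
  have {}Mx : M x by apply: contrapT.
  have [->|v0] := eqVneq v 0; first by exists (x, n).
  have [y [My xy [z hz]]] : exists y, [/\ M y, ball_agree n x y &
      exists z, y (z + v) <> y z].
    apply: contrapT => no'; apply: no; exists v, x, n; split=> // y My xy z.
    by apply: contrapT => hz; apply: no'; exists y; split=> //; exists z.
  (* The new radius reaches both points at which the period fails. *)
  exists (y, maxn n (maxn (vnorm (z + v)) (vnorm z))) => _; split=> //=.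
    exact: leq_maxl.
  move=> _ y' yy' /(_ z); rewrite -!yy' //; rewrite !leq_max leqnn ?orbT //.
have [f hf] := choice step.
(* An enumeration of all vectors; the default 0 is harmless because [step] excludes only nonzero
   vectors. *)
pose e (k : nat) : Z2 := odflt 0 (choice.unpickle k : option Z2).
pose s := fix s (k : nat) : config Z2 A * nat :=
  if k is k'.+1 then f (s k', e k') else (x0, 0%N).
have sM k : M (s k).1.
  by elim: k => [//|k IH] /=; have [] := hf (s k, e k) IH.
have sdec k j : ball_agree (s k).2 (s k).1 (s (j + k)%N).1 /\
    ((s k).2 <= (s (j + k)%N).2)%N.
  elim: j => [//|j [IH1 IH2]]; rewrite addSn /=.
  have [_ h1 h2 _] := hf (s (j + k)%N, e (j + k)%N) (sM _).
  split; last exact: leq_trans h2.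
  by move=> t tk; rewrite IH1 //; apply: h1; apply: leq_trans IH2.
have [|||| y My hy] := @compact_directed_nonempty _ M _ [set: nat]
  (fun k => M `&` [set y | ball_agree (s k).2 (s k).1 y]).
- exact: closed_config_compact.
- by exists 0%N.
- move=> k _; split.
  + apply: closedI => //; apply: (@ball_determined_closed _ _ (s k).2).
    by move=> a b ab /= h t tk; rewrite h // ab.
  + by move=> ? [].
  + by exists (s k).1; split.
- have sub k j y : ball_agree (s (j + k)%N).2 (s (j + k)%N).1 y ->
      ball_agree (s k).2 (s k).1 y.
    have [h1 h2] := sdec k j => h t tk; rewrite h1 // h //.
    exact: leq_trans h2.
  move=> k j _ _; exists (j + k)%N => // y [My h]; split; split=> //.
    exact: sub h.
  by rewrite addnC in h; exact: sub h.
(* The limit [y] is aperiodic: each nonzero [v] is excluded at the stage following its code. *)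
apply: (hap (MX _ My)) => v v0.
have [_ /= h] := hy (choice.pickle v).+1 I.
have [_ _ _ /=] := hf (s (choice.pickle v), e (choice.pickle v)) (sM _).
by rewrite /e choice.pickleK /= in h *; move=> /(_ v0 y h).
Qed.

Theorem finitely_many_periods : finitely_periodic X.
Proof.
apply: contrapT => /minimal_not_finitely_periodic[M [sM MX bM minM]].
have M0 : M !=set0.
  by apply: contrapT => ne; apply: bM; exists [::] => // x Mx; case: ne; exists x.
have [v [x [n [v0 Mx hv]]]] := cylinder_with_common_period (proj1 sM) MX M0.
(* The orbit of the cylinder: by shift invariance its points in [M] all have period [v], and
   minimality covers the rest. *)
pose O := [set y : config Z2 A | exists u, ball_agree n x (shift u y)].
have oO : open O.
  rewrite (_ : O = \bigcup_(u in [set: Z2]) (shift u @^-1` [set y | ball_agree n x y])).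
    apply: bigcup_open => u _; apply: open_comp => [y _|]; first exact: shift_continuous.
    apply: (@ball_determined_open _ _ n) => a b ab /= h t tn.
    by rewrite h // ab.
  by apply/seteqP; split=> y [u]; exists u.
have [|| V V0 cov] := minM O.
- apply: subshiftD_open => // u y [w]; rewrite shift_shift => h.
  by exists (w + u).
- by exists x; split=> //; exists 0; rewrite shift0.
apply: bM; exists (v :: V); first by rewrite inE negb_or eq_sym v0.
move=> y My; have [[u hu]|nO] := pselect (O y).
  exists v; first exact: mem_head.
  by rewrite -(periodic_shift u); apply: hv => //; exact: subshift_shift.
by have [w wV hw] := cov y (conj My nO); exists w => //; rewrite inE wV orbT.
Qed.

End AllPeriodic.

(** * Coding by a one-dimensional subshift *)

Section WindowDetermined.
Variables (G : zmodType) (A : finType).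
Implicit Types (X : set (config G A)) (S : seq G).

(** A local rule without patterns; for shift-invariant sets the next two lemmas relate it to finite
    type. *)
Definition window_determined S X := forall x,
  (forall z, exists2 x', X x' & agree S x' (shift z x)) -> X x.

Lemma finite_type_window X : finite_type X -> exists S, window_determined S X.
Proof.
move=> [F ->]; exists (flatten [seq enum_fset (domf p) | p <- enum_fset F]).
move=> x h p pF [z hz].
have [x' x'F xx'] := h z; apply: (x'F p pF); exists 0 => u up.
rewrite hz // add0r xx' ?[z + u]addrC //.
apply/flattenP; exists (enum_fset (domf p)) => //.
exact: (map_f (fun p : {fmap G -> A} => enum_fset (domf p))) pF.
Qed.

Lemma window_finite_type X S : (forall v, shift v @` X `<=` X) ->
  window_determined S X -> finite_type X.
Proof.
move=> iX wX; pose T := seq_fset tt S.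
pose pat (f : {ffun T -> A}) : {fmap G -> A} := FinMap f.
(* All patterns of support [T] that occur nowhere in [X] are forbidden. *)
exists (seq_fset tt [seq pat f | f <- enum {ffun T -> A} &
  `[< ~ exists2 x, X x & appears (pat f) x >]]).
apply/seteqP; split=> x.
  move=> Xx p; rewrite seq_fsetE => /mapP[f].
  by rewrite mem_filter => /andP[/asboolP no _] -> ap; apply: no; exists x.
move=> av; apply: wX => z; apply: contrapT => no.
pose f : {ffun T -> A} := [ffun t => x (z + val t)].
have pE u (uT : u \in T) (g : {ffun T -> A}) : (pat g).[? u]%fmap = Some (g [` uT]%fset).
  by rewrite in_fnd.
apply: (av (pat f)); last by exists z => u uT; rewrite (pE _ uT) ffunE.
rewrite seq_fsetE; apply/mapP; exists f => //.
rewrite mem_filter mem_enum andbT; apply/asboolP => -[x' Xx' [z' hz']].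
apply: no; exists (shift z' x'); first by apply: iX; exists x'.
move=> s sS; have sT : s \in T by rewrite seq_fsetE.
by have := hz' s sT; rewrite (pE _ sT) ffunE /= /shift ![s + _]addrC => -[].
Qed.

End WindowDetermined.

Lemma addr_eq_sub (G : zmodType) (a b c c' d d' : G) :
  a + c + d = b + c' + d' -> b - a = (c - c') + (d - d').
Proof.
move=> e; have -> : b = a + c + d - d' - c' by rewrite e !addrK.
by rewrite -(addrA (a + c)) addrAC -[a + c + _]addrA [a + _]addrC addrK addrAC.
Qed.

(** For [(1, N)] and [(a, b)] the determinant is [b - N * a]. It is nonzero if [a = 0], as then [b]
    is not zero, and otherwise because [N] exceeds the absolute value of [b]. *)
Lemma transverse_vector (V : seq Z2) : 0 \notin V ->
  exists v, {in V, forall u, vdet v u != 0}.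
Proof.
move=> V0; pose N := (\sum_(u <- V) vnorm u).+1; exists (1, N%:Z) => -[a b] uV.
have lt : (vnorm (a, b) < N)%N by rewrite /N ltnS (big_rem (a, b)) //= leq_addr.
have nz : (a, b) != 0 by apply: contraNneq V0 => <-.
rewrite /vdet /= mul1r; move: lt; rewrite /vnorm /= => lt.
have [a0|a0] := eqVneq a 0.
  by rewrite a0 mulr0 subr0; apply: contraNneq nz => ->; rewrite a0.
apply/eqP => /eqP; rewrite subr_eq0 => /eqP e.
have h : (N <= N * `|a|)%N by rewrite leq_pmulr // absz_gt0.
have e' : `|b|%N = (N * `|a|)%N by rewrite e abszM.
lia.
Qed.

Section Boxes.
Variable M : nat.

Definition box := ('I_M.+1 * 'I_M.+1)%type.
Definition of_box (d : box) : Z2 := (d.1%:Z, d.2%:Z).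
Definition to_box (z : Z2) : box := (inord `|z.1|, inord `|z.2|).

Lemma to_boxK z (d : int) : d != 0 -> (`|d| <= M.+1)%N ->
  of_box (to_box (vrem z d)) = vrem z d.
Proof.
move=> d0 dM; have [p1 p2 h1 h2] := vrem_bound z d0.
rewrite /of_box /= !inordK ?(leq_trans _ dM) // [RHS]surjective_pairing.
by rewrite !gez0_abs.
Qed.

Lemma of_box_norm d : (vnorm (of_box d) <= 2 * M)%N.
Proof. by rewrite /vnorm /= mul2n -addnn leq_add // -ltnS. Qed.

End Boxes.

(** Modulo the lattice of [u] and [u'] each point reduces to a remainder in a finite box, whose
    contents determine the configuration. *)
Lemma finite_doubly_periodic (A : finType) (u u' : Z2) : vdet u u' != 0 ->
  finite_set (periodic A u `&` periodic A u').
Proof.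
move=> d0; set M := `|vdet u u'|%N.
pose g (f : {ffun box M -> A}) : config Z2 A :=
  fun z => f (to_box M (vrem z (vdet u u'))).
apply: (@sub_finite_set _ _ (range g)); last exact/finite_image/finite_finset.
move=> x [hu hu']; exists [ffun d => x (of_box d)] => //.
apply/funext => z; rewrite /g ffunE to_boxK // [in RHS](vdecomp u u' z).
by rewrite addrC addrA !(periodicMz _ hu', periodicMz _ hu).
Qed.

(** * Encoding and decoding *)

Section Coding.
Variables (A : finType) (X : set (config Z2 A)) (V : seq Z2) (v : Z2).
Hypotheses (sX : subshift X) (ncV : noncollinear V).
Hypothesis covX : forall x, X x -> exists2 u, u \in V & periodic A u x.
Hypothesis trv : {in V, forall u, vdet v u != 0}.

Let R := (\sum_(u <- V) vnorm u)%N.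
Let M := (vnorm v * R)%N.
Local Notation D := (box M).

Let normR u : u \in V -> (vnorm u <= R)%N.
Proof. by move=> uV; rewrite /R (big_rem u) //= leq_addr. Qed.

Let det0 (i : seq_sub V) : vdet v (val i) != 0.
Proof. exact: trv (valP i). Qed.

Let detM (i : seq_sub V) : (`|vdet v (val i)| <= M.+1)%N.
Proof.
apply: leq_trans (vdet_norm _ _) _; apply: leq_trans (leqnSn _).
by rewrite leq_mul // normR // (valP i).
Qed.

Let boxK (i : seq_sub V) z :
  of_box (to_box M (vrem z (vdet v (val i)))) = vrem z (vdet v (val i)).
Proof. exact: to_boxK. Qed.

Definition code_alphabet : finType := (seq_sub V * {ffun D -> A})%type.
Local Notation B := code_alphabet.

Definition encode (i : seq_sub V) (x : config Z2 A) : config int B :=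
  fun n => (i, [ffun d => x (v *~ n + of_box d)]).

(** The coefficient of [v] when [vdecomp] splits [z] along [v] and [val i]. *)
Definition strip (i : seq_sub V) (z : Z2) : int :=
  vdet (vquo z (vdet v (val i))) (val i).

(** The period [val i] allows dropping its multiple from the decomposition of [z]. The label may be
    read at 0 because it is constant along a code. *)
Definition decode (y : config int B) : config Z2 A :=
  fun z => let i := (y 0).1 in
    (y (strip i z)).2 (to_box M (vrem z (vdet v (val i)))).

Lemma strip_decomp i z : exists m,
  z = v *~ strip i z + val i *~ m + vrem z (vdet v (val i)).
Proof. by exists (vdet v (vquo z (vdet v (val i)))); exact: vdecomp. Qed.

Lemma encodeK i x : periodic A (val i) x -> decode (encode i x) = x.
Proof.
move=> hx; apply/funext => z; rewrite /decode /encode /= ffunE boxK.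
have [m {3}->] := strip_decomp i z.
by rewrite addrAC (periodicMz m hx).
Qed.

Lemma encode_shift i x (n : int) : encode i (shift (v *~ n) x) = shift n (encode i x).
Proof.
apply/funext => k; rewrite /encode /shift; congr (_, _); apply/ffunP => d.
by rewrite !ffunE mulrzDr addrAC.
Qed.

Lemma encode_continuous i : continuous (encode i).
Proof.
apply: (@locally_determined_continuous _ _ _ _ _
  (fun n => [seq v *~ n + of_box d | d <- enum {: D}])) => n x y xy.
rewrite /encode; congr (_, _); apply/ffunP => d; rewrite !ffunE; apply: xy.
by apply: (map_f (fun d => v *~ n + of_box d)); rewrite mem_enum.
Qed.

Lemma decode_continuous : continuous decode.
Proof.
apply: (@locally_determined_continuous _ _ _ _ _
  (fun z => 0 :: [seq strip i z | i <- enum {: seq_sub V}])) => z x y xy.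
rewrite /decode xy ?mem_head // xy // inE; apply/orP; right.
by apply: (map_f (fun i => strip i z)); rewrite mem_enum.
Qed.

Definition coded : set (config int B) :=
  \bigcup_(i in [set: seq_sub V]) (encode i @` (X `&` periodic A (val i))).

Lemma coded_subshift : subshift coded.
Proof.
split; last first.
  move=> n _ [_ [i _ [x [Xx hx] <-]] <-]; exists i => //.
  exists (shift (v *~ n) x); last exact: encode_shift.
  by split; [exact: subshift_shift|rewrite periodic_shift].
have -> : coded = \big[setU/set0]_(i <- enum {: seq_sub V})
    (encode i @` (X `&` periodic A (val i))).
  rewrite -bigcup_seq (_ : [set` enum _] = setT) //.
  by apply/seteqP; split=> i //= _; rewrite mem_enum.
apply: closed_bigsetU => i _; apply: compact_closed; first exact: config_hausdorff.
apply: continuous_compact.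
  by apply: continuous_subspaceT; exact: encode_continuous.
by apply: closed_config_compact; apply: closedI; [case: sX|exact: closed_periodic].
Qed.

Lemma decode_coded_image : decode @` coded = X.
Proof.
apply/seteqP; split=> [_ [_ [i _ [x [Xx hx] <-]] <-]|x Xx]; first by rewrite encodeK.
have [u uV hu] := covX Xx; pose i : seq_sub V := SeqSub uV.
by exists (encode i x); [exists i => //; exists x|rewrite encodeK].
Qed.

Lemma decode_shift y : coded y -> decode (shift 1 y) = shift v (decode y).
Proof.
move=> [i _ [x [Xx hx] <-]]; rewrite -encode_shift mulr1z !encodeK //.
by rewrite periodic_shift.
Qed.

(** With one label, [encodeK] gives injectivity; two labels for one configuration force two
    noncollinear periods, and [E] holds all codes of such configurations. *)
Lemma decode_almost_injective :
  exists E : set (config int B), finite_set E /\ set_inj (coded `\` E) decode.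
Proof.
pose E := \bigcup_(ijk in [set p : seq_sub V * seq_sub V * seq_sub V | p.1.1 != p.1.2])
  (encode ijk.2 @` (periodic A (val ijk.1.1) `&` periodic A (val ijk.1.2))).
exists E; split.
  apply: bigcup_finite => [|[[i j] k] /= ij]; first exact: finite_finset.
  apply: finite_image; apply: finite_doubly_periodic.
  by apply: ncV (valP i) (valP j) _; rewrite (inj_eq val_inj).
move=> y y' /set_mem[[i _ [x [Xx hx] <-]] nE] /set_mem[[j _ [x' [Xx' hx'] <-]] _].
rewrite !encodeK // => e; rewrite -e in hx' *.
have [->//|ij] := eqVneq i j; exfalso; apply: nE.
by exists (i, j, i) => //; exists x.
Qed.

(** * Local rules for the codes *)

Section Window.
Variables (S : seq Z2) (wS : window_determined S X).

(** Bounds the displacements to which [key] is applied: box entries, remainders, and remainders plus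
    vectors of [S]. *)
Let C := (2 * M + 2 * M.+1 + \sum_(s <- S) vnorm s)%N.
(** The product is the bound from [strip_bound]; the successor lets a window at [n] see the label at
    [n + 1]. *)
Let W := ((C + 2 * M.+1) * R).+1.
Let SY : seq int := [seq k%:Z - W%:Z | k <- iota 0 (W + W).+1].

Let memSY (k : int) : (`|k| <= W)%N -> k \in SY.
Proof.
move=> kW; apply/mapP; exists `|(k + W%:Z)%R|%N; last lia.
by rewrite mem_iota; lia.
Qed.

Let rem_norm (i : seq_sub V) z : (vnorm (vrem z (vdet v (val i))) <= 2 * M.+1)%N.
Proof.
have [_ _ h1 h2] := vrem_bound z (det0 i); rewrite /vnorm mul2n -addnn.
by apply: leq_add; apply: leq_trans (detM i); apply: ltnW.
Qed.

(** Taking determinants with [val i] removes its multiples and leaves [vdet v (val i) * (q - n) =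
    vdet (d - w) (val i)]. *)
Let strip_bound (i : seq_sub V) (n m : int) d : (vnorm d <= C)%N ->
  (`|(strip i (v *~ n + val i *~ m + d) - n)%R| <= W)%N.
Proof.
move=> dC; set z := _ + d; set q := strip i z; pose w := vrem z (vdet v (val i)).
have [m' e] := strip_decomp i z.
have {}e : v *~ (q - n) = val i *~ (m - m') + (d - w).
  rewrite (mulrzBr v q n) (mulrzBr _ m m').
  exact: (@addr_eq_sub _ (v *~ n) (v *~ q) (val i *~ m) (val i *~ m') d w e).
have {}e : vdet v (val i) * (q - n) = vdet (d - w) (val i).
  by rewrite -vdetMl e (vdetDl (val i *~ (m - m'))) vdetMl vdetvv mul0r add0r.
have : (`|vdet (d - w) (val i)| <= (C + 2 * M.+1) * R)%N.
  apply: leq_trans (vdet_norm _ _) _; apply: leq_mul; last exact: normR (valP i).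
  apply: leq_trans (vnormD _ _) _; rewrite vnormN; apply: leq_add => //.
  exact: rem_norm.
rewrite -e abszM => le; apply: leq_trans (leqnSn _); apply: leq_trans le.
by rewrite leq_pmull // absz_gt0 det0.
Qed.

Lemma coded_window_determined : window_determined SY coded.
Proof.
move=> y hy.
have W1 : (1 <= W)%N by [].
have lab n : (y (n + 1)).1 = (y n).1.
  have [_ [i _ [x [Xx hx] <-]] h] := hy n.
  have := h 0 (memSY _) ; have := h 1 (memSY _).
  by rewrite /shift add0r addrC => <- // <-.
pose i := (y 0).1.
have labi n : (y n).1 = i.
  elim/int_rec: n => [//|n IH|n IH]; first by rewrite intS addrC lab.
  by rewrite -IH intS opprD [_ - n%:Z]addrC -[LHS]lab addrNK.
have hx n : exists x, [/\ X x, periodic A (val i) x &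
    forall k, (`|k| <= W)%N -> y (k + n) = encode i x k].
  have [_ [j _ [x [Xx hx] <-]] h] := hy n.
  have ji : j = i.
    by rewrite -(labi n); have := h 0 (memSY _); rewrite /shift add0r => <-.
  exists x; rewrite -ji; split=> // k kW; rewrite h //; exact: memSY.
pose x := decode y.
(* Near every point [v *~ n + val i *~ m], decoding reads only the window at [n], so [x] looks there
   like [x'] near the origin. *)
have key n x' m d : periodic A (val i) x' ->
    (forall k, (`|k| <= W)%N -> y (k + n) = encode i x' k) ->
    (vnorm d <= C)%N -> x (v *~ n + val i *~ m + d) = x' d.
  move=> hx' hy' dC; have := strip_bound i n m dC; set z := _ + d => sb.
  rewrite /x /decode -/i -[strip i z](subrK n) hy' // ffunE boxK.
  have [m' e] := strip_decomp i z.
  have -> : v *~ (strip i z - n) + vrem z (vdet v (val i)) = d + val i *~ (m - m').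
    rewrite (mulrzBr v _ n) (mulrzBr _ m m').
    by rewrite (@addr_eq_sub _ (v *~ n) _ (val i *~ m) _ d _ e) addrA addrNK addrC.
  exact: periodicMz hx' _.
have remC z : (vnorm (vrem z (vdet v (val i))) <= C)%N.
  by apply: leq_trans (rem_norm i z) _; rewrite /C; lia.
have Xx : X x.
  apply: wS => z; have [m e] := strip_decomp i z.
  have [x' [Xx' hx' hy']] := hx (strip i z).
  exists (shift (vrem z (vdet v (val i))) x'); first exact: subshift_shift.
  move=> s sS; rewrite /shift [s + z]addrC {2}e -addrA (key _ x') 1?[s + _]addrC //.
  apply: leq_trans (vnormD _ _) _.
  have sN : (vnorm s <= \sum_(s <- S) vnorm s)%N.
    by rewrite (big_rem s) //= leq_addr.
  by apply: leq_trans (leq_add (rem_norm i z) sN) _; rewrite /C -addnA leq_addl.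
have px : periodic A (val i) x.
  move=> z; have [m e] := strip_decomp i z.
  have [x' [Xx' hx' hy']] := hx (strip i z).
  have e' : z + val i = v *~ strip i z + val i *~ (m + 1) + vrem z (vdet v (val i)).
    by rewrite {1}e (mulrzDr _ m 1) mulr1z [in RHS]addrA; exact: addrAC.
  by rewrite e' (key _ x') // [in RHS]e (key _ x').
exists i => //; exists x => //; apply/funext => n.
have [x' [Xx' hx' hy']] := hx n.
rewrite -[y n](congr1 y (add0r n)) hy' // /encode; congr (_, _); apply/ffunP => d.
rewrite !ffunE mulr0z add0r -(key n x' 0 (of_box d)) ?mulr0z ?addr0 //.
by apply: leq_trans (of_box_norm d) _; rewrite /C; lia.
Qed.

End Window.

End Coding.

(** * The almost conjugacy *)

Theorem theorem11 (A : finType) (X : set (config (int * int)%type A))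
    (hX : subshift X) (hap : forall x, X x -> ~ aperiodic x) :
  exists (v : int * int) (B : finType) (Y : set (config int B)),
    [/\ subshift Y,
        almost_conjugate X (shift v) Y (shift (1 : int))
      & finite_type X -> finite_type Y].
Proof.
have [V [ncV V0 cov]] := noncollinear_cover (finitely_many_periods hX hap).
have [v trv] := transverse_vector V0.
have sY := coded_subshift V v hX.
exists v, (code_alphabet A V v), (coded X (V := V) (v := v)); split=> //; last first.
  move=> /finite_type_window[S wS].
  by apply: window_finite_type (coded_window_determined hX trv wS); case: sY.
have dX : dynamical_system X (shift v).
  split; [by apply: closed_config_compact; case: hX|by case: hX|].
  by apply: continuous_subspaceT; exact: shift_continuous.
have dY : dynamical_system (coded X (V := V) (v := v)) (shift (1 : int)).
  split; [by apply: closed_config_compact; case: sY|by case: sY|].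
  by apply: continuous_subspaceT; exact: shift_continuous.
split=> //.
(* The coded subshift is its own common extension: it maps to [X] by [decode] and to itself by the
   identity. *)
exists _, (coded X (V := V) (v := v)), (shift (1 : int)), (@decode A V v), id.
split=> //; split.
- by apply: continuous_subspaceT; exact: decode_continuous.
- exact: decode_coded_image.
- exact: decode_almost_injective.
- by move=> y /(decode_shift trv).
- by apply: continuous_subspaceT => y; exact: cvg_id.
- exact: image_id.
- by exists set0; split; [exact: finite_set0|move=> ? ? _ _].
- by [].
Qed.
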